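(* Let $\{\mathbb{X}_n\}_{n\in\mathbb{N}}$ be a sequence of non-trivial normed linear spaces over $\mathbb{K}$. (i) A point $x=\{x_n\}_{n\in\mathbb{N}}\in\bigoplus_1\mathbb{X}_n$ is smooth if and only if $x_n\in\mathbb{X}_n$ is smooth for every $n\in\mathbb{N}$. (ii) A point $x=\{x_n\}_{n\in\mathbb{N}}\in\bigoplus_0\mathbb{X}_n$ is smooth if and only if there exists a natural number $n_0$ such that $\|x_n\|<\|x\|_0$ for every $n\neq n_0$ and $x_{n_0}\in\mathbb{X}_{n_0}$ is smooth.
   Context: $\mathbb{K}=\mathbb{R}$ or $\mathbb{C}$; non-trivial means of dimension more than $0$. $\bigoplus_1\mathbb{X}_n$ and $\bigoplus_0\mathbb{X}_n$ are the spaces of sequences $\{x_n\}$, $x_n\in\mathbb{X}_n$, with respectively $\sum_n\|x_n\|<\infty$ and $\lim_n\|x_n\|=0$, normed by $\|\{x_n\}\|_1=\sum_n\|x_n\|$ and $\|\{x_n\}\|_0=\max_n\|x_n\|$. An element $x$ of a normed space $\mathbb{X}$ is smooth if it is non-zero and there is exactly one $f\in\mathbb{X}^*$ with $\|f\|=1$ and $f(x)=\|x\|$ (so $0$ is not a smooth point). *)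

(* Defs.v *)
From HB Require Import structures.
From mathcomp Require Import all_boot all_order all_algebra.
From mathcomp Require Import boolp classical_sets functions reals.
From mathcomp Require Import topology normedtype sequences.
From mathcomp Require Import complex.

Set Implicit Arguments.
Unset Strict Implicit.
Unset Printing Implicit Defensive.

Import Order.TTheory GRing.Theory Num.Theory.
Import numFieldNormedType.Exports.

Local Open Scope classical_set_scope.
Local Open Scope ring_scope.

(* The norm of a [normedModType K] takes its values in [K]; for the complex
   numbers these values are nonnegative for the partial order of [R[i]], i.e.
   they are nonnegative real numbers. *)
Definition real_or_complex (R : realType) (K : numFieldType) : Prop :=
  K = R :> numFieldType \/ K = R[i] :> numFieldType.

Section Smooth.
Variables (K : numFieldType) (X : normedModType K).

Definition nontrivial : Prop := exists v : X, v != 0.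

Definition topdual : set (X -> K^o) := [set f | linear f /\ continuous f].

(* [supremum] is the least upper bound for the order of [K]; as the set is
   made of nonnegative scalars and is bounded when [f] is continuous and linear,
   it exists for real and for complex scalars. *)
Definition dual_norm (f : X -> K^o) : K :=
  supremum 0 [set `|f x| | x in [set x : X | `|x| <= 1]].

Definition smooth (x : X) : Prop :=
  x != 0 /\
  exists! f : X -> K^o, [/\ topdual f, dual_norm f = 1 & f x = `|x|].

End Smooth.
Arguments nontrivial {K} X.

Section Product.
Variables (K : numFieldType) (X : nat -> normedModType K).

(* An alias, so as not to put a module structure on every dependent product. *)
Definition prodseq : Type := forall n, X n.

HB.instance Definition _ := gen_eqMixin prodseq.
HB.instance Definition _ := gen_choiceMixin prodseq.

Implicit Types x y z : prodseq.

Definition prodseq_add x y : prodseq := fun n => x n + y n.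
Definition prodseq_opp x : prodseq := fun n => - x n.
Definition prodseq_zero : prodseq := fun n => 0.
Definition prodseq_scale (a : K) x : prodseq := fun n => a *: x n.

Let addA : associative prodseq_add.
Proof. by move=> x y z; apply: functional_extensionality_dep => n;
   exact: addrA. Qed.
Let addC : commutative prodseq_add.
Proof. by move=> x y; apply: functional_extensionality_dep => n;
   exact: addrC. Qed.
Let add0 : left_id prodseq_zero prodseq_add.
Proof. by move=> x; apply: functional_extensionality_dep => n;
   exact: add0r. Qed.
Let addN : left_inverse prodseq_zero prodseq_opp prodseq_add.
Proof. by move=> x; apply: functional_extensionality_dep => n;
   exact: addNr. Qed.
HB.instance Definition _ := GRing.isZmodule.Build prodseq addA addC add0 addN.

Let scaleA a b x :
  prodseq_scale a (prodseq_scale b x) = prodseq_scale (a * b) x.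
Proof. by apply: functional_extensionality_dep => n;
   exact: scalerA. Qed.
Let scale1 : left_id 1 prodseq_scale.
Proof. by move=> x; apply: functional_extensionality_dep => n;
   exact: scale1r. Qed.
Let scaleDr : right_distributive prodseq_scale +%R.
Proof. by move=> a x y; apply: functional_extensionality_dep => n;
   exact: scalerDr. Qed.
Let scaleDl x : {morph prodseq_scale^~ x : a b / a + b}.
Proof. by move=> a b; apply: functional_extensionality_dep => n;
   exact: scalerDl. Qed.
HB.instance Definition _ :=
  GRing.Zmodule_isLmodule.Build K prodseq scaleA scale1 scaleDr scaleDl.

End Product.

Section NumFieldLimits.
Variable K : numFieldType.

Lemma lim_ge0 (u : nat -> K) (l : K) :
  u @ \oo --> l -> (\forall n \near \oo, 0 <= u n) -> 0 <= l.
Proof.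
move=> ul u0; apply: contrapT => l0.
have e0 : 0 < `| `|l| - l|.
  rewrite normr_gt0 subr_eq0; apply/eqP => ll; apply: l0.
  by rewrite -ll normr_ge0.
have e20 : 0 < `| `|l| - l| / 2 by rewrite divr_gt0.
have [n [un0 ln]] : exists n, 0 <= u n /\ `|l - u n| < `| `|l| - l| / 2.
  near \oo => n; exists n; split; near: n => //.
  by apply: (@cvgrPdist_lt _ _ _ _ _ u l).1 ul _ e20.
have : `| `|l| - l| <= `|l - u n| + `|l - u n|.
  have -> : `|l| - l = (`|l| - `|u n|) + (u n - l).
    by rewrite (ger0_norm un0) addrA subrK.
  rewrite (le_trans (ler_normD _ _))// (distrC (u n)) lerD2r.
  exact: ler_dist_dist.
move=> /le_lt_trans /(_ (ltrD ln ln)).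
by rewrite -splitr ltxx.
Unshelve. all: by end_near. Qed.

Lemma lim_ge (u : nat -> K) (a l : K) :
  u @ \oo --> l -> (\forall n \near \oo, a <= u n) -> a <= l.
Proof.
move=> ul ua; rewrite -subr_ge0; apply: (@lim_ge0 (fun n => u n - a)).
  by apply: cvgB => //; exact: cvg_cst.
by apply: filterS ua => n; rewrite subr_ge0.
Qed.

Lemma sum_norm_le_lim (X : nat -> normedModType K) (x : forall n, X n) k :
  cvgn (series (fun n => `|x n|)) ->
  series (fun n => `|x n|) k <= limn (series (fun n => `|x n|)).
Proof.
move=> cx; apply: (lim_ge cx); exists k => // n /= kn.
by apply: nondecreasing_series => // i _ _.
Qed.

End NumFieldLimits.

Lemma nondecreasing_bounded_cvg (R : realType) (K : numFieldType)
    (hK : real_or_complex R K) (u : nat -> K) (M : K) :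
  nondecreasing_seq u -> (forall n, 0 <= u n <= M) -> cvgn u.
Proof.
case: hK => EK; subst K => u_nd u_bd.
  apply: nondecreasing_is_cvgn => //.
  by exists M => _ [n _ <-]; case/andP: (u_bd n).
have uE n : u n = ((complex.Re (u n))%:C)%C.
  by rewrite RRe_real// ger0_real//; case/andP: (u_bd n).
have ME : M = ((complex.Re M)%:C)%C.
  rewrite RRe_real// ger0_real//; case/andP: (u_bd 0%N).
  exact: le_trans.
have : cvgn (fun n => complex.Re (u n)).
  apply: nondecreasing_is_cvgn => [m n mn|].
    by rewrite -lecR -!uE; exact: u_nd.
  exists (complex.Re M) => _ [n _ <-]; rewrite -lecR -uE -ME.
  by case/andP: (u_bd n).
set l := limn _ => ul; apply/cvg_ex; exists (l%:C)%C.
apply/(@cvgrPdist_lt _ _ _ _ _ u) => e e0.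
have eE : e = ((complex.Re e)%:C)%C by rewrite RRe_real// gtr0_real.
have e0' : 0 < complex.Re e by rewrite -ltcR -eE.
have /cvgrPdist_lt /(_ _ e0') := ul; apply: filterS => n.
by rewrite uE -rmorphB normc_def/= expr0n/= addr0 sqrtr_sqr -/l eE ltcR.
Qed.

Definition summable (K : numFieldType) (X : nat -> normedModType K) :
    {pred prodseq X} :=
  mem [set x : prodseq X | cvgn (series (fun n => `|x n|))].

(* [hK] is a parameter because closure under addition requires bounded
   nondecreasing sequences of nonnegative scalars to converge. *)
Record l1sum (R : realType) (K : numFieldType) (hK : real_or_complex R K)
    (X : nat -> normedModType K) :=
  L1sum { l1seq :> forall n, X n ;
          _ : (l1seq : prodseq X) \in @summable K X }.

Section L1sumTheory.
Variables (R : realType) (K : numFieldType) (hK : real_or_complex R K).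
Variable X : nat -> normedModType K.

Let summable_submod : submod_closed (@summable K X).
Proof.
have h0 : (0 : prodseq X) \in @summable K X.
  rewrite inE/=; apply/cvg_ex; exists 0.
  rewrite [X in X @ _](_ : _ = cst 0); first exact: cvg_cst.
  by apply/funext => n; rewrite /series/= big1// => i _; exact: normr0.
split=> // a x y; rewrite !inE/= => cx cy.
pose M := `|a| * limn (series (fun n => `|x n|)) +
          limn (series (fun n => `|y n|)).
apply: (nondecreasing_bounded_cvg hK (M := M)).
  by apply: nondecreasing_series => n _ _; exact: normr_ge0.
move=> n; rewrite sumr_ge0//=.
rewrite (@le_trans _ _ (\sum_(0 <= i < n) (`|a| * `|x i| + `|y i|)))//.
  by apply: ler_sum => i _; rewrite (le_trans (ler_normD _ _))// normrZ.
rewrite big_split/= -mulr_sumr lerD//; last exact: (sum_norm_le_lim n cy).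
by rewrite ler_wpM2l//; exact: (sum_norm_le_lim n cx).
Qed.

HB.instance Definition _ := GRing.isSubmodClosed.Build K (prodseq X) (@summable K X)
  summable_submod.

HB.instance Definition _ := [isSub of l1sum hK X for (@l1seq R K hK X : _ -> prodseq X)].
HB.instance Definition _ := [Choice of l1sum hK X by <:].
HB.instance Definition _ := [SubChoice_isSubZmodule of l1sum hK X by <:].
HB.instance Definition _ := [SubZmodule_isSubLmodule of l1sum hK X by <:].

Definition l1norm (x : l1sum hK X) : K := limn (series (fun n => `|x n|)).

Let l1sumP (x : l1sum hK X) : cvgn (series (fun n => `|x n|)).
Proof. by case: x => x /=; rewrite inE. Qed.

Let l1norm_triangle x y : l1norm (x + y) <= l1norm x + l1norm y.
Proof.
rewrite -subr_ge0; apply: (@lim_ge0 _ (fun n => (series (fun n => `|x n|) n +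
   series (fun n => `|y n|) n) - series (fun n => `|(x + y) n|) n)).
  by apply: cvgB; [apply: cvgD|]; exact: l1sumP.
near=> n; rewrite subr_ge0 -big_split/=; apply: ler_sum => i _.
exact: ler_normD.
Unshelve. all: by end_near. Qed.

Let l1normZ (a : K) x : l1norm (a *: x) = `|a| * l1norm x.
Proof.
apply: cvg_lim; first exact: norm_hausdorff.
rewrite [X in X @ _](_ : _ = fun n => `|a| * series (fun n => `|x n|) n).
  by apply: cvgMr; exact: l1sumP.
apply/funext => n; rewrite /series/= mulr_sumr.
by apply: eq_bigr => i _; exact: normrZ.
Qed.

Let l1norm_eq0 x : l1norm x = 0 -> x = 0.
Proof.
move=> x0; apply/val_inj/functional_extensionality_dep => n /=.
apply/eqP; rewrite -normr_eq0 eq_le normr_ge0 andbT -x0.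
apply: le_trans (sum_norm_le_lim n.+1 (@l1sumP x)).
by rewrite /series/= big_nat_recr//= lerDr sumr_ge0.
Qed.

HB.instance Definition _ := Lmodule_isNormed.Build K (l1sum hK X)
  l1norm_triangle l1normZ l1norm_eq0.

End L1sumTheory.

Definition vanishing (K : numFieldType) (X : nat -> normedModType K) :
    {pred prodseq X} :=
  mem [set x : prodseq X | (fun n => `|x n|) @ \oo --> (0 : K)].

Record c0sum (K : numFieldType) (X : nat -> normedModType K) :=
  C0sum { c0seq :> forall n, X n ;
          _ : (c0seq : prodseq X) \in @vanishing K X }.

Section C0sumTheory.
Variables (K : numFieldType) (X : nat -> normedModType K).

Let vanishing_submod : submod_closed (@vanishing K X).
Proof.
split=> [|a x y]; rewrite !inE/=.
  rewrite [X in X @ _](_ : _ = cst 0); first exact: cvg_cst.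
  by apply/funext => n; exact: normr0.
move=> cx cy.
have cv : (fun n => `|a| * `|x n| + `|y n|) @ \oo --> (0 : K).
  by rewrite -[0]addr0 -[X in X + _](mulr0 `|a|); apply: cvgD => //; exact: cvgMr.
apply/(@cvgrPdist_lt _ _ _ _ _ (fun n => `|(a *: x + y) n|)) => e e0.
move/cvgrPdist_lt : cv => /(_ _ e0); apply: filterS => n.
rewrite !sub0r !normrN normr_id.
rewrite ger0_norm ?addr_ge0 ?mulr_ge0//; apply: le_lt_trans.
by rewrite (le_trans (ler_normD _ _))// normrZ.
Qed.

HB.instance Definition _ := GRing.isSubmodClosed.Build K (prodseq X)
  (@vanishing K X) vanishing_submod.

HB.instance Definition _ := [isSub of c0sum X for (@c0seq K X : _ -> prodseq X)].
HB.instance Definition _ := [Choice of c0sum X by <:].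
HB.instance Definition _ := [SubChoice_isSubZmodule of c0sum X by <:].
HB.instance Definition _ := [SubZmodule_isSubLmodule of c0sum X by <:].

Definition c0norm (x : c0sum X) : K :=
  xget 0 [set r | (exists n, r = `|x n|) /\ (forall n, `|x n| <= r)].

Let c0sumP (x : c0sum X) : (fun n => `|x n|) @ \oo --> (0 : K).
Proof. by case: x => x /=; rewrite inE. Qed.

(* The maximum picked by [c0norm] always exists. *)
Lemma c0norm_max x : (exists n, c0norm x = `|x n|) /\
  (forall n, `|x n| <= c0norm x).
Proof.
suff [m xm] : exists m, forall n, `|x n| <= `|x m|.
  by rewrite /c0norm; case: xgetP => [_ -> [] //|/(_ `|x m|)[]]; split => //; exists m.
have [x0|/existsNP[k /eqP xk]] := pselect (forall n, `|x n| = 0).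
  by exists 0%N => n; rewrite !x0.
have xk0 : 0 < `|x k| by rewrite lt_def xk normr_ge0.
have [N _ xN] := (@cvgrPdist_lt _ _ _ _ _ (fun n => `|x n|) 0).1 (@c0sumP x) _ xk0.
have maxE M : exists m, forall n, (n < M.+1)%N -> `|x n| <= `|x m|.
  elim: M => [|M [m mM]]; first by exists 0%N => -[].
  have [le|lt] := real_leP (normr_real (x M.+1)) (normr_real (x m)).
    exists m => n; rewrite ltnS leq_eqVlt => /orP[/eqP ->//|]; exact: mM.
  exists M.+1 => n; rewrite ltnS leq_eqVlt => /orP[/eqP ->//|].
  by move=> /mM /le_trans -> //; exact: ltW.
have [m mN] := maxE (maxn N k); exists m => n.
have [/mN//|nN] := ltnP n (maxn N k).+1.
apply: (@le_trans _ _ `|x k|); last by apply: mN; rewrite ltnS leq_maxr.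
have /xN : (N <= n)%N by rewrite (leq_trans _ nN)// (leq_trans (leq_maxl _ k)).
by rewrite /= sub0r normrN normr_id => /ltW.
Qed.

Let c0norm_triangle x y : c0norm (x + y) <= c0norm x + c0norm y.
Proof.
have [[n ->] _] := c0norm_max (x + y).
rewrite (le_trans (ler_normD _ _))// lerD//; first exact: (c0norm_max x).2.
exact: (c0norm_max y).2.
Qed.

Let c0normZ (a : K) x : c0norm (a *: x) = `|a| * c0norm x.
Proof.
have [[n nE] nP] := c0norm_max (a *: x); have [[m mE] mP] := c0norm_max x.
apply: le_anti; apply/andP; split.
  by rewrite nE normrZ ler_wpM2l//; exact: mP.
by rewrite mE -normrZ; exact: nP.
Qed.

Let c0norm_eq0 x : c0norm x = 0 -> x = 0.
Proof.
move=> x0; apply/val_inj/functional_extensionality_dep => n /=.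
apply/eqP; rewrite -normr_eq0 eq_le normr_ge0 andbT.
by have := (c0norm_max x).2 n; rewrite x0.
Qed.

HB.instance Definition _ := Lmodule_isNormed.Build K (c0sum X)
  c0norm_triangle c0normZ c0norm_eq0.

End C0sumTheory.

(* Main.v *)
(** By Hahn-Banach, [x] is smooth in a non-trivial space iff at most one
functional of norm at most [1] takes the value [`|x|] at [x]: at [0] there are
always two of them. Since [`|y| = `|y - y_n| + `|y_n|] in the l1-sum, a
functional supports [x] iff each of its coordinates supports [x_n], and the
coordinates can be exchanged independently of each other. In the c0-sum, a
functional supporting a coordinate [x_m] of maximal norm, composed with the
projection, supports [x], so that a smooth [x] attains its norm only once.
Conversely, if the norm is attained only at [n0], adding to [x] small multiples
of a [y] with [y_n0 = 0] does not increase the norm, hence a functional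
supporting [x] vanishes at [y] and depends only on the coordinate [n0]. *)

From HB Require Import structures.
Require Import Defs.
From mathcomp Require Import all_boot all_order all_algebra.
From mathcomp Require Import boolp classical_sets functions reals.
From mathcomp Require Import topology normedtype sequences.
From mathcomp Require Import complex.
From mathcomp Require Import lra.

Set Implicit Arguments.
Unset Strict Implicit.
Unset Printing Implicit Defensive.

Import Order.TTheory GRing.Theory Num.Theory.
Import numFieldNormedType.Exports.

Local Open Scope classical_set_scope.
Local Open Scope ring_scope.

(** * Hahn-Banach theorem for sublinear functionals on real vector spaces *)

Section HahnBanach.
Variables (R : realType) (V : lmodType R).
Implicit Types (p q : V -> R) (u v : V).

(** One inequality suffices for homogeneity: applied to the inverse factor, it gives the other. *)
Definition sublinear q :=
  (forall u v, q (u + v) <= q u + q v) /\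
  (forall c v, 0 < c -> q (c *: v) <= c * q v).

Lemma sublinear0 q : sublinear q -> q 0 = 0.
Proof.
(* The factor 2 gives [0 <= q 0], the factor 1/2 gives [q 0 <= 0]. *)
move=> [_ qZ]; have := qZ 2 0 (ltr0n _ 2); have := qZ 2^-1 0.
by rewrite !scaler0 invr_gt0 ltr0n => /(_ isT); lra.
Qed.

Lemma sublinearZ q c v : sublinear q -> 0 <= c -> q (c *: v) = c * q v.
Proof.
move=> sq; rewrite le_eqVlt => /orP[/eqP <-|c0].
  by rewrite scale0r mul0r sublinear0.
apply/eqP; rewrite eq_le sq.2//= -ler_pdivlMl//.
by rewrite -[in leLHS](scalerK (lt0r_neq0 c0) v) sq.2 ?invr_gt0.
Qed.

Lemma sublinearN_ge q v : sublinear q -> - q (- v) <= q v.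
Proof.
move=> sq; rewrite -subr_ge0 opprK -(sublinear0 sq) -(subrr v).
exact: sq.1.
Qed.

(* [slope q a] is sublinear, below [q], and its value at [- a] is at most
   [- q a]: so a minimal [q] is linear, and a linear functional below [slope p x]
   agrees with [p] at [x]. *)
Definition slope q a v : R :=
  inf [set q (v + t *: a) - t * q a | t in [set t | 0 <= t]].

Lemma slope_le q a v t : sublinear q -> 0 <= t ->
  slope q a v <= q (v + t *: a) - t * q a.
Proof.
move=> sq t0; apply: ge_inf; last by exists t.
(* The infimum is finite: [q (s *: a) <= q (v + s *: a) + q (- v)]. *)
exists (- q (- v)) => _ [s s0 <-]; rewrite -(sublinearZ _ sq)//.
rewrite lerBrDr addrC lerBlDr.
by rewrite -{1}(addKr v (s *: a)) addrC sq.1.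
Qed.

Lemma le_slope q a v r :
  (forall t, 0 <= t -> r <= q (v + t *: a) - t * q a) -> r <= slope q a v.
Proof.
move=> rP; apply: lb_le_inf; first by exists (q (v + 0 *: a) - 0 * q a), 0 => /=.
by move=> _ [t t0 <-]; exact: rP.
Qed.

Lemma slope_le_self q a v : sublinear q -> slope q a v <= q v.
Proof.
move=> sq; have := slope_le a v sq (lexx 0).
by rewrite scale0r addr0 mul0r subr0.
Qed.

Lemma slope_sublinear q a : sublinear q -> sublinear (slope q a).
Proof.
move=> sq; split=> [u v|c v c0].
  rewrite -lerBlDr; apply: le_slope => t t0.
  rewrite lerBlDr [leRHS]addrC -lerBlDr; apply: le_slope => s s0.
  (* Parameters [t] for [u] and [s] for [v] are matched by [t + s] for [u + v]. *)
  rewrite lerBlDr (le_trans (slope_le a (u + v) sq (addr_ge0 t0 s0)))//.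
  rewrite scalerDl addrACA.
  have := sq.1 (u + t *: a) (v + s *: a); lra.
rewrite -ler_pdivrMl//; apply: le_slope => t t0.
rewrite ler_pdivrMl// (le_trans (slope_le a _ sq (mulr_ge0 (ltW c0) t0)))//.
by rewrite -scalerA -scalerDr (sublinearZ _ sq (ltW c0)) mulrBr mulrA.
Qed.

(** Zorn's lemma for the reversed pointwise order. A nonempty chain is bounded by its pointwise
    infimum, which is finite since each member is at least [- p (- v)] at [v]. *)
Lemma minimal_sublinear p : sublinear p ->
  exists q, [/\ sublinear q, forall v, q v <= p v &
    forall q', sublinear q' -> (forall v, q' v <= q v) -> q' = q].
Proof.
move=> sp.
pose T := {q : V -> R | sublinear q /\ forall v, q v <= p v}.
pose ord (q q' : T) := `[< forall v, sval q' v <= sval q v >].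
have [| | | |[q [sq qp]] qmin] := @Zorn T ord.
- by move=> q; apply/asboolP.
- move=> q1 q2 q3 /asboolP q12 /asboolP q23; apply/asboolP => v.
  exact: le_trans (q23 v) (q12 v).
- move=> [q1 P1] [q2 P2] /asboolP/= q12 /asboolP/= q21; apply/eq_exist/funext => v.
  by apply/eqP; rewrite eq_le q12 q21.
- move=> A Atot; have [[q0 Aq0]|A0] := pselect (A !=set0); last first.
    have pP : sublinear p /\ forall v, p v <= p v by [].
    by exists (exist _ p pP) => q Aq; case: A0; exists q.
  pose m v := inf [set sval q v | q in A].
  have m_le (q : T) v : A q -> m v <= sval q v.
    move=> Aq; apply: ge_inf; last by exists q.
    exists (- p (- v)) => _ [[q' [sq' q'p]] _ <-] /=.
    by rewrite (le_trans _ (sublinearN_ge _ sq'))// lerN2.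
  have le_m v r : (forall q : T, A q -> r <= sval q v) -> r <= m v.
    move=> rP; apply: lb_le_inf; first by exists (sval q0 v), q0.
    by move=> _ [q Aq <-]; exact: rP.
  have sm : sublinear m.
    split=> [u v|c v c0].
      rewrite -lerBlDr; apply/le_m => q1 Aq1.
      rewrite lerBlDr [leRHS]addrC -lerBlDr; apply/le_m => q2 Aq2; rewrite lerBlDr.
      (* The smaller of the two functionals serves for both [u] and [v]. *)
      have [/asboolP q12|/asboolP q21] := Atot _ _ Aq1 Aq2.
        rewrite (le_trans (m_le _ _ Aq2))// (le_trans ((svalP q2).1.1 _ _))//.
        by rewrite addrC lerD2l.
      rewrite (le_trans (m_le _ _ Aq1))// (le_trans ((svalP q1).1.1 _ _))//.
      by rewrite addrC lerD2r.
    rewrite -ler_pdivrMl//; apply/le_m => q Aq; rewrite ler_pdivrMl//.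
    by rewrite (le_trans (m_le _ _ Aq))// (svalP q).1.2.
  have mP : sublinear m /\ forall v, m v <= p v.
    by split=> // v; exact: le_trans (m_le q0 v Aq0) ((svalP q0).2 v).
  by exists (exist _ m mP) => q Aq; apply/asboolP => v; exact: m_le.
exists q; split=> // q' sq' q'q.
have q'P : sublinear q' /\ forall v, q' v <= p v.
  by split=> // v; exact: le_trans (q'q v) (qp v).
suff /qmin/(congr1 sval) : ord (exist _ q (conj sq qp)) (exist _ q' q'P) by [].
exact/asboolP.
Qed.

Theorem hahn_banach p (x : V) : sublinear p ->
  exists f : V -> R^o, [/\ linear f, forall v, f v <= p v & f x = p x].
Proof.
move=> sp; have [f [sf fp fmin]] := minimal_sublinear (slope_sublinear x sp).
have fD u v : f (u + v) = f u + f v.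
  apply/eqP; rewrite eq_le sf.1/=.
  (* By minimality [slope f v] is [f], so [t = 1] yields [f u <= f (u + v) - f v]. *)
  have := slope_le v u sf ler01; rewrite scale1r mul1r.
  rewrite (fmin _ (slope_sublinear v sf) (fun w => slope_le_self v w sf)); lra.
have fN v : f (- v) = - f v.
  by apply/eqP; rewrite -addr_eq0 -fD addNr sublinear0.
exists f; split=> [c u v|v|].
- rewrite fD; congr (_ + _); have [c0|c0] := leP 0 c; first exact: sublinearZ.
  rewrite -[c *: u]opprK fN -scaleNr sublinearZ ?oppr_ge0 ?ltW//.
  by rewrite mulNr opprK.
- exact: le_trans (fp v) (slope_le_self x v sp).
- apply/eqP; rewrite eq_le (le_trans (fp x) (slope_le_self x x sp))/=.
  have := le_trans (fp (- x)) (slope_le x (- x) sp ler01).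
  by rewrite fN scale1r mul1r addNr sublinear0// sub0r lerN2.
Qed.

End HahnBanach.

(** * Norming functionals over real and complex scalars *)

Section Realification.
Variables (R : realType) (V : lmodType R[i]).

(** An alias, to keep the real module structure apart from the complex one. *)
Definition realification : Type := V.

HB.instance Definition _ := GRing.Zmodule.on realification.

Definition real_scale (a : R) (v : realification) : realification :=
  (a%:C)%C *: (v : V).

Let real_scaleA a b v : real_scale a (real_scale b v) = real_scale (a * b) v.
Proof. by rewrite /real_scale scalerA -rmorphM. Qed.
Let real_scale1 : left_id 1 real_scale.
Proof. by move=> v; rewrite /real_scale rmorph1 scale1r. Qed.
Let real_scaleDr : right_distributive real_scale +%R.
Proof. by move=> a u v; exact: scalerDr. Qed.
Let real_scaleDl v : {morph real_scale^~ v : a b / a + b}.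
Proof. by move=> a b; rewrite /real_scale rmorphD; exact: scalerDl. Qed.
HB.instance Definition _ := GRing.Zmodule_isLmodule.Build R realification
  real_scaleA real_scale1 real_scaleDr real_scaleDl.

End Realification.

(* For [x != 0] this is the condition in [smooth]; at [0] it also holds of the
   zero functional. *)
Definition supports (K : numFieldType) (X : normedModType K) (f : X -> K^o)
    (x : X) : Prop :=
  [/\ linear f, forall y, `|f y| <= `|y| & f x = `|x|].

(** The squared modulus is at most [r ^+ 2], which the real part alone already reaches, so the
    imaginary part vanishes. *)
Lemma complex_eq_of_norm_le (R : realType) (z : R[i]) (r : R) :
  r <= complex.Re z -> `|z| <= (r%:C)%C -> z = (r%:C)%C.
Proof.
move=> rz zr; have r0 : 0 <= r by rewrite -ler0c (le_trans _ zr).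
have : `|z| ^+ 2 <= (r%:C)%C ^+ 2 by rewrite lerXn2r// nnegrE// ler0c.
rewrite -add_Re2_Im2 -rmorphXn lecR; case: z rz {zr} => a b /= ra ab.
have b0 : b = 0 by apply/eqP; rewrite -sqrf_eq0; nra.
by move: ab; rewrite b0 expr0n addr0 => ab; congr Complex; nra.
Qed.

Lemma complex_supports (R : realType) (X : normedModType R[i]) (x : X) :
  exists f, supports f x.
Proof.
have normE (v : X) : `|v| = ((complex.Re `|v|)%:C)%C.
  by rewrite RRe_real// normr_real.
pose p (v : realification X) : R := complex.Re `|v : X|.
have pP : sublinear p.
  split=> [u v|c v c0]; rewrite -lecR.
    by rewrite rmorphD /p/= -!normE; exact: (@ler_normD _ X).
  rewrite rmorphM /p/= -!normE normrZ gtr0_norm// ltcR//.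
have [f [flin fp fx]] := hahn_banach (x : realification X) pP.
have fD u v : f (u + v) = f u + f v.
  by have := flin 1 u v; rewrite !scale1r.
have f0 : f 0 = 0 by have := fD 0 0; rewrite addr0; lra.
have fZ (a : R) (v : X) : f ((a%:C)%C *: v) = a * f v.
  by have := flin a v 0; rewrite f0 !addr0.
(* The only complex-linear functional with real part [f]. *)
pose F (v : X) : R[i]^o := Complex (f v) (- f ('i%C *: v)).
have fN u : f (- u) = - f u by apply/eqP; rewrite -addr_eq0 -fD addNr f0.
have FZ c u : F (c *: u) = c * F u.
  case: c => a b; rewrite /F scalerA.
  have -> : ('i * Complex a b = a%:C * 'i - b%:C)%C by simpc.
  have -> : (Complex a b = a%:C + b%:C * 'i)%C by simpc.
  rewrite !scalerDl.
  rewrite scaleNr -!scalerA !fD fN !fZ.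
  by simpc; congr Complex; lra.
have Flin : linear F.
  move=> c u v; rewrite -[c *: F u]/(c * F u) -FZ /F scalerDr !fD.
  by simpc; congr Complex; lra.
have Fle v : `|F v| <= `|v|.
  have [->|Fv0] := eqVneq (F v) 0; first by rewrite normr0.
  (* A unimodular [c] rotates [F v] to a nonnegative real, where the bound on the real part [f]
     applies. *)
  pose c := `|F v| / F v.
  have Fc : F (c *: v) = `|F v| by rewrite FZ divfK.
  have fc : f (c *: v) = complex.Re `|F v| by rewrite -Fc.
  rewrite -[`|F v|]RRe_real ?normr_real// (normE v) lecR -fc (le_trans (fp _))// /p normrZ.
  by rewrite normrM normfV normr_id divff ?normr_eq0// mul1r.
exists F; split=> //.
by rewrite [RHS](normE x); apply: complex_eq_of_norm_le; rewrite /= ?fx// -(normE x).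
Qed.

Lemma norming_functional (R : realType) (K : numFieldType)
    (hK : real_or_complex R K) (X : normedModType K) (x : X) :
  exists f, supports f x.
Proof.
case: hK => EK; subst K; last exact: complex_supports.
have nP : sublinear (fun v : X => `|v|).
  by split=> [u v|c v c0]; [exact: ler_normD|rewrite normrZ gtr0_norm].
have [f [flin fle fx]] := hahn_banach x nP.
exists f; split=> // v; rewrite ler_norml fle andbT lerNl -normrN.
have f0 : f 0 = 0 by have := flin 1 0 0; rewrite !scale1r addr0; lra.
by have := flin (-1) v 0; rewrite f0 !addr0 !scaleN1r => <-.
Qed.

(* Strict convexity of the modulus at the real number [a + b]. *)
Lemma eq_of_norm_le_add (R : realType) (K : numFieldType)
    (hK : real_or_complex R K) (z w a b : K) :
  `|z| <= a -> `|w| <= b -> z + w = a + b -> z = a.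
Proof.
case: hK => EK; subst K => za wb zw.
  by have := ler_norm z; have := ler_norm w; lra.
have aE : a = ((complex.Re a)%:C)%C.
  by rewrite RRe_real// ger0_real// (le_trans _ za).
have bE : b = ((complex.Re b)%:C)%C.
  by rewrite RRe_real// ger0_real// (le_trans _ wb).
rewrite aE; apply: complex_eq_of_norm_le; rewrite -?aE//.
have := le_trans (normc_ge_Re w) wb; rewrite bE lecR.
have := congr1 (@complex.Re R) zw; rewrite !raddfD/=.
by have := ler_norm (complex.Re w); lra.
Qed.

(** * Supporting functionals and smoothness *)

Section Supports.
Variables (K : numFieldType) (X : normedModType K).
Implicit Types (f g : X -> K^o) (x : X).

Lemma linear_scalar0 f : linear f -> f 0 = 0.
Proof.
move=> flin; have := flin 1 0 0; rewrite !scale1r addr0 => /eqP.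
by rewrite -subr_eq0 opprD addNKr oppr_eq0 => /eqP.
Qed.

Lemma linear_scalarZ f a x : linear f -> f (a *: x) = a * f x.
Proof. by move=> flin; have := flin a x 0; rewrite linear_scalar0// !addr0. Qed.

Lemma linear_scalarD f x y : linear f -> f (x + y) = f x + f y.
Proof. by move=> flin; have := flin 1 x y; rewrite !scale1r. Qed.

Lemma linear_scalarB f x y : linear f -> f (x - y) = f x - f y.
Proof.
by move=> flin; rewrite linear_scalarD// -scaleN1r linear_scalarZ// mulN1r.
Qed.

Lemma linear_continuous_of_norm_le f :
  linear f -> (forall y, `|f y| <= `|y|) -> continuous f.
Proof.
move=> flin fle.
pose F : {linear X -> K^o} :=
  HB.pack f (GRing.isLinear.Build _ _ _ _ f flin).
apply: (@bounded_linear_continuous _ _ _ F); apply/bounded_funP => r.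
by exists r => y; exact: le_trans (fle y).
Qed.

Lemma norm_le_of_dual_norm1 f y :
  linear f -> dual_norm f = 1 -> `|f y| <= `|y|.
Proof.
(* [supremum] defaults to 0 on an empty set or when no least upper bound exists; the value 1
   excludes both. *)
move=> flin; rewrite /dual_norm /supremum; case: ifP => [_ /esym/eqP|_].
  by rewrite oner_eq0.
case: xgetP => [s _ [f_ub _] s1|_ /esym/eqP]; last by rewrite oner_eq0.
have [->|y0] := eqVneq y 0; first by rewrite linear_scalar0// !normr0.
have ny0 : 0 < `|y| by rewrite normr_gt0.
have : `|f (`|y|^-1 *: y)| <= 1.
  rewrite -s1; apply: f_ub; exists (`|y|^-1 *: y) => //=.
  by rewrite normrZ normfV normr_id mulVf ?lt0r_neq0.
by rewrite linear_scalarZ// normrM normfV normr_id ler_pdivrMl// mulr1.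
Qed.

Lemma dual_norm_supports f x : x != 0 -> supports f x -> dual_norm f = 1.
Proof.
move=> x0 [flin fle fx].
have supr1 : supremums [set `|f y| | y in [set y : X | `|y| <= 1]] 1.
  split=> [_ [y y1 <-]|s]; first exact: le_trans (fle y) y1.
  apply; exists (`|x|^-1 *: x) => /=.
    by rewrite normrZ normfV normr_id mulVf ?normr_eq0.
  by rewrite linear_scalarZ// fx mulVf ?normr_eq0// normr1.
rewrite /dual_norm /supremum; case: ifP => [/eqP A0|_].
  suff : set0 `|f 0| by [].
  by rewrite -A0; exists 0 => //=; rewrite normr0.
by apply: (@is_subset1_supremums _ _ _ _ _ _ supr1); case: xgetP => // /(_ _ supr1).
Qed.

Lemma supports0 : supports (fun=> 0 : K^o) (0 : X).
Proof. by split=> [a u v|y|]; rewrite ?scaler0 ?addr0 ?normr0. Qed.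

(** Replaces continuity and the dual norm by a pointwise bound. Existence is Hahn-Banach, so only
    uniqueness remains. *)
Lemma smoothP (R : realType) (hK : real_or_complex R K) x : nontrivial X ->
  smooth x <-> forall f g, supports f x -> supports g x -> f = g.
Proof.
move=> [v v0]; split=> [[x0 [h [_ h_uniq]]] f g fx gx|uniq].
  have fE e : supports e x -> h = e.
    move=> ex; apply: h_uniq; split; last by case: ex.
      by case: ex => ? ? _; split=> //; exact: linear_continuous_of_norm_le.
    exact: dual_norm_supports ex.
  by rewrite -(fE f fx) -(fE g gx).
have x0 : x != 0.
  (* At 0, uniqueness would identify a functional norming [v] with the zero functional. *)
  apply: contra_neq v0 => x0; apply/eqP; rewrite -normr_eq0.
  have [g [glin gle gv]] := norming_functional hK v.
  rewrite -gv (uniq g (fun=> 0))//.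
  - by rewrite x0; split=> //; rewrite normr0 linear_scalar0.
  - by rewrite x0; exact: supports0.
split=> //; have [f fx] := norming_functional hK x; exists f; split.
  split; [|exact: dual_norm_supports fx|by case: fx].
  by case: fx => ? ? _; split=> //; exact: linear_continuous_of_norm_le.
move=> g [[glin _] g1 gx]; apply: uniq => //; split=> // y.
exact: norm_le_of_dual_norm1.
Qed.

End Supports.

(** * Vectors supported on a single coordinate *)

Section Coordinates.
Variables (K : numFieldType) (X : nat -> normedModType K).

Definition coord_vec n (z : X n) : prodseq X := @dfwith nat X (fun k => 0) n z.

Lemma coord_vec_linear n : linear (@coord_vec n).
Proof.
move=> a u v; apply: functional_extensionality_dep => k.
have [e|nk] := eqVneq n k.
  by subst k; rewrite /coord_vec dfwith_in /GRing.add/= /prodseq_add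
    /GRing.scale/= /prodseq_scale !dfwith_in.
rewrite /coord_vec dfwith_out// /GRing.add/= /prodseq_add.
by rewrite /GRing.scale/= /prodseq_scale !dfwith_out// scaler0 addr0.
Qed.

Lemma norm_coord_vec_le n (z : X n) k : `|coord_vec z k| <= `|z|.
Proof.
have [e|nk] := eqVneq n k; first by subst k; rewrite /coord_vec dfwith_in.
by rewrite /coord_vec dfwith_out// normr0.
Qed.

Lemma sub_coord_vec (y : forall k, X k) n k :
  y k - coord_vec (y n) k = if k == n then 0 else y k.
Proof.
rewrite /coord_vec; case: eqVneq => [->|kn]; first by rewrite dfwith_in subrr.
by rewrite dfwith_out 1?eq_sym// subr0.
Qed.

Lemma coord_vec_summable n (z : X n) : coord_vec z \in @summable K X.
Proof.
rewrite inE/=; apply/cvg_ex; exists `|z|; apply: cvg_near_cst.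
exists n.+1 => // m /= nm; rewrite /series/= (bigD1_seq n) ?iota_uniq//=; last first.
  by rewrite mem_index_iota.
rewrite big1 ?addr0 /coord_vec ?dfwith_in// => k kn.
by rewrite dfwith_out ?normr0// eq_sym.
Qed.

Lemma coord_vec_vanishing n (z : X n) : coord_vec z \in @vanishing K X.
Proof.
rewrite inE/=; apply: cvg_near_cst; exists n.+1 => // m /= nm.
by rewrite /coord_vec dfwith_out ?normr0// neq_ltn nm.
Qed.

End Coordinates.

(** * An abstract l1-summand [Z] of a normed space [Y] *)

Section L1Summand.
Variables (R : realType) (K : numFieldType) (hK : real_or_complex R K).
Variables (Y Z : normedModType K) (i : Z -> Y) (p : Y -> Z).
Hypotheses (ilin : linear i) (plin : linear p) (iK : cancel i p).
Hypothesis norm_split : forall y, `|y| = `|y - i (p y)| + `|p y|.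

Lemma l1summand_norm z : `|i z| = `|z|.
Proof. by rewrite norm_split iK subrr normr0 add0r. Qed.

(** The values of [f] at the two components of [y] are bounded by norms whose sum is [f y]; hence
    both bounds are equalities. *)
Lemma l1summand_supports f y : supports f y -> supports (f \o i) (p y).
Proof.
move=> [flin fle fy]; split=> [a u v|z|] /=.
- by rewrite ilin flin.
- by rewrite -[leRHS]l1summand_norm.
apply: (eq_of_norm_le_add hK (w := f (y - i (p y))) (b := `|y - i (p y)|)).
- by rewrite -l1summand_norm.
- exact: fle.
- by rewrite linear_scalarB// addrC subrK fy norm_split addrC.
Qed.

(** Keeps [f] on the complement of the summand and puts [g] on the summand; additivity of the norm
    preserves the bound. *)
Lemma l1summand_supports_exchange f g y : supports f y -> supports g (p y) ->
  supports (fun u => f (u - i (p u)) + g (p u) : K^o) y.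
Proof.
move=> fy gy; have [_ _ fip] := l1summand_supports fy.
case: fy gy => flin fle fy [glin gle gpy]; split=> [a u v|u|].
- rewrite plin ilin opprD addrACA -scalerBr flin glin scalerDr.
  by rewrite -!addrA; congr (_ + _); rewrite addrCA.
- by rewrite (norm_split u) (le_trans (ler_normD _ _))// lerD.
- by rewrite linear_scalarB// fy [f (i _)]fip gpy subrK.
Qed.

Lemma l1summand_unique_support y :
  (forall f g, supports f y -> supports g y -> f = g) ->
  forall f g, supports f (p y) -> supports g (p y) -> f = g.
Proof.
move=> uniq f g fy gy; have [e ey] := norming_functional hK y.
apply/funext => z.
(* Both functionals share the part from [e], which cancels at [i z] and leaves [f z = g z]. *)
have := uniq _ _ (l1summand_supports_exchange ey fy)
  (l1summand_supports_exchange ey gy).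
by move=> /(congr1 (fun h => h (i z)))/addrI; rewrite iK.
Qed.

End L1Summand.

(** * Smooth points of the l1-sum *)

Section L1Sum.
Variables (R : realType) (K : numFieldType) (hK : real_or_complex R K).
Variable X : nat -> normedModType K.
Implicit Types y : l1sum hK X.

Definition l1inj n (z : X n) : l1sum hK X := L1sum hK (coord_vec_summable z).

Lemma l1inj_linear n : linear (@l1inj n).
Proof. by move=> a u v; apply/val_inj; exact: coord_vec_linear. Qed.

Lemma l1injK n : cancel (@l1inj n) (fun y => y n).
Proof. by move=> z; rewrite /= /coord_vec dfwith_in. Qed.

Lemma l1norm_cvg y : series (fun n => `|y n|) @ \oo --> `|y|.
Proof. by case: y => y ys; exact: (set_mem ys). Qed.

Lemma l1sub_coord y n k :
  (y - l1inj (y n)) k = if k == n then 0 else y k.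
Proof. exact: sub_coord_vec. Qed.

Lemma l1norm_split n y : `|y| = `|y - l1inj (y n)| + `|y n|.
Proof.
have c : (fun m => series (fun k => if k == n then 0 else `|y k|) m + `|y n|)
    @ \oo --> `|y - l1inj (y n)| + `|y n|.
  apply: cvgD; last exact: cvg_cst.
  rewrite (_ : (fun k => _) = fun k => `|(y - l1inj (y n)) k|).
    exact: l1norm_cvg.
  by apply/funext => k; rewrite l1sub_coord; case: ifP => // _; rewrite normr0.
apply: cvg_lim; first exact: norm_hausdorff.
(* Partial sums contain the term of index [n] only from length [n.+1] on. *)
apply: (cvg_trans _ c); apply: near_eq_cvg; exists n.+1 => // m /= nm.
have nin : n \in index_iota 0 m by rewrite mem_index_iota.
rewrite /series/= 2?(bigD1_seq n nin) ?iota_uniq//= eqxx add0r addrC.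
by congr (_ + _); apply: eq_bigr => k /negbTE ->.
Qed.

(* Both functionals have the same difference at all tails of [y], whose norms
   tend to [0]. *)
Lemma l1_functional_ext (f g : l1sum hK X -> K^o) :
  linear f -> linear g ->
  (forall y, `|f y| <= `|y|) -> (forall y, `|g y| <= `|y|) ->
  (forall n, f \o @l1inj n = g \o @l1inj n) -> f = g.
Proof.
move=> flin glin fle gle fg; apply/funext => y.
have tail n : exists t : l1sum hK X,
    [/\ forall k, (n <= k)%N -> t k = y k,
        `|t| = `|y| - series (fun k => `|y k|) n & f t - g t = f y - g y].
  elim: n => [|n [t [ty tn fgt]]].
    by exists y; split=> //; rewrite /series/= big_geq// subr0.
  exists (t - l1inj (t n)); split=> [k nk||].
  - by rewrite l1sub_coord gtn_eqF// ty// ltnW.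
  - apply: (addIr `|t n|); rewrite -l1norm_split tn ty//.
    by rewrite /series/= big_nat_recr//= opprD addrA subrK.
  - have -> : f (t - l1inj (t n)) = f t - f (l1inj (t n)) by exact: linear_scalarB.
    have -> : g (t - l1inj (t n)) = g t - g (l1inj (t n)) by exact: linear_scalarB.
    have /(congr1 (fun h => h (t n)))/= -> := fg n.
    by rewrite opprD addrACA subrr addr0.
(* The factor 2 is one tail norm for each of [f] and [g]. *)
have c : (fun n => 2 * (`|y| - series (fun k => `|y k|) n) - `|f y - g y|)
    @ \oo --> 2 * (`|y| - `|y|) - `|f y - g y|.
  apply: cvgB; last exact: cvg_cst.
  by apply: cvgMr; apply: cvgB; [exact: cvg_cst|exact: l1norm_cvg].
have : 0 <= 2 * (`|y| - `|y|) - `|f y - g y|.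
  apply: (lim_ge0 c); exists 0%N => // n _ /=; have [t [_ <- <-]] := tail n.
  rewrite subr_ge0 mulr_natl mulr2n (le_trans (ler_normB _ _))//.
  by apply: lerD; [exact: fle|exact: gle].
rewrite subrr mulr0 add0r.
by rewrite oppr_ge0 normr_le0 subr_eq0 => /eqP.
Qed.

Lemma l1sum_smooth (hX : forall n, nontrivial (X n)) y :
  smooth y <-> forall n, smooth (y n).
Proof.
have l1X : nontrivial (l1sum hK X).
  have [v v0] := hX 0%N; exists (l1inj v); apply: contra_neq v0 => v0.
  by rewrite -(l1injK v) v0.
have plin n : linear (fun y => y n) by [].
rewrite (smoothP hK)//; split=> [uniq n|ysmooth f g fy gy].
  apply/(smoothP hK _ (hX n)).
  exact: (l1summand_unique_support hK (@l1inj_linear n) (plin n) (@l1injK n)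
    (@l1norm_split n)).
have [[flin fle _] [glin gle _]] := (fy, gy).
apply: l1_functional_ext => // n; apply/(smoothP hK _ (hX n)).1 => //.
  exact: (l1summand_supports hK (@l1inj_linear n) (@l1injK n) (@l1norm_split n)).
exact: (l1summand_supports hK (@l1inj_linear n) (@l1injK n) (@l1norm_split n)).
Qed.

End L1Sum.

(** * Smooth points of the c0-sum *)

Section C0Sum.
Variables (R : realType) (K : numFieldType) (hK : real_or_complex R K).
Variable X : nat -> normedModType K.
Implicit Types x y : c0sum X.

Definition c0inj n (z : X n) : c0sum X := C0sum (coord_vec_vanishing z).

Lemma c0inj_linear n : linear (@c0inj n).
Proof. by move=> a u v; apply/val_inj; exact: coord_vec_linear. Qed.

Lemma c0injK n : cancel (@c0inj n) (fun y => y n).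
Proof. by move=> z; rewrite /= /coord_vec dfwith_in. Qed.

Lemma c0norm_coord_le x n : `|x n| <= `|x|.
Proof. exact: (c0norm_max x).2. Qed.

Lemma c0norm_attained x : exists n, `|x| = `|x n|.
Proof. exact: (c0norm_max x).1. Qed.

Lemma c0norm_le x r : (forall n, `|x n| <= r) -> `|x| <= r.
Proof. by move=> xr; have [n ->] := c0norm_attained x. Qed.

Lemma c0inj_norm_le n (z : X n) : `|c0inj z| <= `|z|.
Proof. by apply: c0norm_le => k; exact: norm_coord_vec_le. Qed.

Lemma c0sub_coord y n k :
  (y - c0inj (y n)) k = if k == n then 0 else y k.
Proof. exact: sub_coord_vec. Qed.

Lemma supports_coord x n (g : X n -> K^o) :
  `|x n| = `|x| -> supports g (x n) -> supports (fun y => g (y n) : K^o) x.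
Proof.
move=> xn [glin gle gx]; split=> [a u v|y|].
- exact: glin.
- exact: le_trans (gle _) (c0norm_coord_le y n).
- by rewrite gx.
Qed.

(* As [`|x +- s *: y| <= `|x|] for a small [s > 0], the scalars
   [f x +- s * f y] have modulus at most [f x]. *)
Lemma supports_eq0 x n (f : c0sum X -> K^o) y :
  (forall k, k <> n -> `|x k| < `|x|) -> x != 0 ->
  supports f x -> y n = 0 -> f y = 0.
Proof.
move=> xlt x0 [flin fle fx] yn0.
have Mx0 : 0 < `|x| by rewrite normr_gt0.
pose d := `|x - c0inj (x n)|.
have dlt : d < `|x|.
  (* The norm is an attained maximum, so the strict inequalities at the coordinates give a uniform
     gap. *)
  rewrite /d; have [k ->] := c0norm_attained (x - c0inj (x n)).
  by rewrite c0sub_coord; case: eqVneq => [_|/eqP/xlt//]; rewrite normr0.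
have dk k : k <> n -> `|x k| <= d.
  move=> /eqP/negbTE kn; have := c0norm_coord_le (x - c0inj (x n)) k.
  by rewrite c0sub_coord kn.
(* Small enough that [s *: y] fits in the gap; the summand 1 keeps the denominator positive when [y]
   is 0. *)
pose s := (`|x| - d) / (1 + `|y|).
have y1 : 0 < 1 + `|y| by rewrite ltr_wpDr.
have s0 : 0 < s by rewrite divr_gt0// subr_gt0.
have sy : s * `|y| <= `|x| - d.
  rewrite /s mulrAC ler_pdivrMr// ler_wpM2l//; last by rewrite lerDr.
  by rewrite subr_ge0 ltW.
have xsy (t : K) : `|t| = s -> `|f x + t * f y| <= `|x|.
  move=> ts; rewrite -linear_scalarZ// -linear_scalarD//.
  apply: le_trans (fle _) _; apply: c0norm_le => k.
  have -> : (x + t *: y) k = x k + t *: y k by [].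
  have [->|/eqP kn] := eqVneq k n.
    by rewrite yn0 scaler0 addr0 c0norm_coord_le.
  rewrite (le_trans (ler_normD _ _))// normrZ ts.
  rewrite -(subrK d `|x|) [leRHS]addrC lerD ?dk//.
  by rewrite (le_trans _ sy)// ler_pM2l// c0norm_coord_le.
(* The scalars for [s] and [- s] add up to twice the bound on their moduli, so each equals it. *)
have : f x + s * f y = `|x|.
  apply: (eq_of_norm_le_add hK (w := f x + - s * f y) (b := `|x|)).
  - by apply: xsy; rewrite gtr0_norm.
  - by apply: xsy; rewrite normrN gtr0_norm.
  - by rewrite mulNr addrACA subrr addr0 fx.
rewrite fx -[RHS]addr0 => /addrI/eqP; rewrite mulf_eq0 (gt_eqF s0)/=.
by move/eqP.
Qed.

Lemma c0sum_smooth (hX : forall n, nontrivial (X n)) x :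
  smooth x <-> exists n0,
    (forall n, n <> n0 -> `|x n| < `|x|) /\ smooth (x n0).
Proof.
have c0X : nontrivial (c0sum X).
  have [v v0] := hX 0%N; exists (c0inj v); apply: contra_neq v0 => v0.
  by rewrite -(c0injK v) v0.
split=> [xsmooth|[n [xlt xnsmooth]]].
  have x0 := xsmooth.1; have uniq := (smoothP hK x c0X).1 xsmooth.
  have [m xm] := c0norm_attained x; have {}xm := esym xm; exists m; split.
    move=> n nm; rewrite lt_neqAle c0norm_coord_le andbT; apply/eqP => xn.
    have [f fx] := norming_functional hK (x n).
    have [g gx] := norming_functional hK (x m).
    (* At [c0inj (x m)] the functional through [n] gives 0, the one through [m] gives the nonzero
       norm of [x]. *)
    have := uniq _ _ (supports_coord xn fx) (supports_coord xm gx).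
    move=> /(congr1 (fun h => h (c0inj (x m)))); rewrite c0injK.
    have -> : c0inj (x m) n = 0.
      by rewrite /= /coord_vec dfwith_out// eq_sym; apply/eqP.
    case: fx gx => flin _ _ [_ _ ->]; rewrite linear_scalar0// xm => /esym/eqP.
    by rewrite normr_eq0 (negbTE x0).
  apply/(smoothP hK _ (hX m)) => f g fx gx; apply/funext => z.
  have := uniq _ _ (supports_coord xm fx) (supports_coord xm gx).
  by move=> /(congr1 (fun h => h (c0inj z))); rewrite c0injK.
have x0 : x != 0 by apply: contra_neq xnsmooth.1 => ->.
have xn : `|x n| = `|x|.
  have [m xm] := c0norm_attained x; have [<-//|/eqP/xlt] := eqVneq m n.
  by rewrite xm ltxx.
have fE f : supports f x -> forall y, f y = f (c0inj (y n)).
  move=> fx y; apply/eqP; rewrite -subr_eq0 -linear_scalarB; last by case: fx.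
  (* [y - c0inj (y n)] vanishes at the coordinate [n], hence lies in the kernel of [f]. *)
  by apply/eqP; apply: (supports_eq0 xlt x0 fx); rewrite c0sub_coord eqxx.
have fn f : supports f x -> supports (f \o @c0inj n) (x n).
  move=> fx; have [flin fle fxx] := fx; split=> [a u v|z|] /=.
  - by rewrite c0inj_linear flin.
  - exact: le_trans (fle _) (c0inj_norm_le z).
  - by rewrite -fE// fxx.
apply/(smoothP hK _ c0X) => f g fx gx; apply/funext => y.
rewrite (fE _ fx) (fE _ gx).
have := (smoothP hK _ (hX n)).1 xnsmooth _ _ (fn _ fx) (fn _ gx).
by move=> /(congr1 (fun h => h (y n))).
Qed.

End C0Sum.

Theorem corollary16 (R : realType) (K : numFieldType)
    (hK : real_or_complex R K) (X : nat -> normedModType K)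
    (hX : forall n, nontrivial (X n)) :
  (forall x : l1sum hK X, smooth x <-> forall n, smooth (x n)) /\
  (forall x : c0sum X, smooth x <->
     exists n0, (forall n, n <> n0 -> `|x n| < `|x|) /\ smooth (x n0)).
Proof.
by split=> x; [exact: l1sum_smooth|exact: (c0sum_smooth hK)].
Qed.
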